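(* Let $(G,p)$ be a countable bar-joint framework in $\mathbb{R}^d$ with bounded bar lengths. Then the following implications hold for $(G,p)$: infinitesimally rigid (IR) $\implies$ boundedly infinitesimally rigid (BIR) $\implies$ boundedly prestress stable (BPS) $\implies$ weakly boundedly prestress stable (WBPS) $\implies$ directedly continuously rigid (DCR).
   Context: **Frameworks.** A countable bar-joint framework $(G,p)$ in $\mathbb{R}^d$ is a countably infinite simple graph $G=(V,E)$, $V=\{1,2,\dots\}$, with a placement $p=(p_1,p_2,\dots)$, $p_i\in\mathbb{R}^d$. It has bounded bar lengths if $\sup_{ij\in E}|p_i-p_j|<\infty$. **Flexes.** An infinitesimal flex is a velocity field $u=(u_i)$, $u_i\in\mathbb{R}^d$, with $(p_i-p_j)\cdot(u_i-u_j)=0$ for all $ij\in E$. It is trivial if it is a rigid motion flex, i.e. $u_i=Ap_i+b$ for all $i$, with $A$ a skew-symmetric $d\times d$ matrix and $b\in\mathbb{R}^d$. It is bounded if it belongs to $\ell^\infty\otimes\mathbb{R}^d$, the space of sequences $u$ in $\mathbb{R}^d$ with $\|u\|=\sup_k|u_k|<\infty$, where $|\cdot|$ is the Euclidean norm. **Stresses.** A stress is a function $\omega:E\to\mathbb{R}$, with the conventions $\omega_{ij}=\omega_{ji}$ and $\omega_{ij}=0$ if $i=j$ or $ij\notin E$. It is an equilibrium stress for $(G,p)$ if $\sum_j\omega_{ij}(p_i-p_j)=0$ for every vertex $i$, and it is summable if $\sum_{i<j}|\omega_{ij}|<\infty$. **IR:** every infinitesimal flex is trivial. **BIR:** there are no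 infinitesimal flexes which are both nontrivial and bounded. **BPS:** there is a summable equilibrium stress $\omega$ such that $\sum_{i<j}\omega_{ij}|u_i-u_j|^2>0$ for all bounded nontrivial infinitesimal flexes $u$. **WBPS:** for each nontrivial bounded infinitesimal flex $u$ there is a summable equilibrium stress $\omega$ (which may depend on $u$) with $\sum_{i<j}\omega_{ij}|u_i-u_j|^2>0$. **DCR:** A continuous motion of $(G,p)$ is a family $p(t)=(p_k(t))_{k}$, $t\in[0,1]$, with each $p_k(t)\in\mathbb{R}^d$ continuous in $t$, $p(0)=p$, and $|p_i(t)-p_j(t)|=|p_i-p_j|$ for all $ij\in E$ and all $t$. A directed bounded motion is a continuous motion for which the limit $\lim_{t\to0+}(p(t)-p(0))/t=(p_k'(0))_k$ exists with respect to norm convergence in $\ell^\infty\otimes\mathbb{R}^d$; it is nontrivial if the infinitesimal flex $p'(0)$ is nontrivial. $(G,p)$ is DCR if it has no nontrivial directed bounded motions. *)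

(* Defs.v *)
From HB Require Import structures.
From mathcomp Require Import all_boot all_order all_algebra.
From mathcomp Require Import all_classical all_reals all_analysis.

Set Implicit Arguments.
Unset Strict Implicit.
Unset Printing Implicit Defensive.

Import Order.TTheory GRing.Theory Num.Theory.
Import numFieldNormedType.Exports.

Local Open Scope classical_set_scope.
Local Open Scope ring_scope.

(* The library norm on 'cV[R]_d is the max norm, so the Euclidean one is
   defined here. *)
Definition dotv (R : realType) (d : nat) (x y : 'cV[R]_d) : R :=
  \sum_(k < d) x k 0 * y k 0.

Definition eucl_norm (R : realType) (d : nat) (x : 'cV[R]_d) : R :=
  Num.sqrt (dotv x x).

(* Vertices are numbered 0, 1, 2, ... instead of 1, 2, 3, ... *)
Record framework (R : realType) (d : nat) := Framework {
  edge : rel nat;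
  edge_sym : symmetric edge;
  edge_irr : irreflexive edge;
  pos : nat -> 'cV[R]_d
}.

Definition bounded_bar_lengths (R : realType) (d : nat) (F : framework R d) :
    Prop :=
  (ereal_sup [set x | exists i j, edge F i j /\
                x = (eucl_norm (pos F i - pos F j))%:E] < +oo)%E.

Definition linfty_norm (R : realType) (d : nat) (u : nat -> 'cV[R]_d) : \bar R :=
  ereal_sup (range (fun k => (eucl_norm (u k))%:E)).

Definition bounded_field (R : realType) (d : nat) (u : nat -> 'cV[R]_d) : Prop :=
  (linfty_norm u < +oo)%E.

Definition inf_flex (R : realType) (d : nat) (F : framework R d)
    (u : nat -> 'cV[R]_d) : Prop :=
  forall i j, edge F i j -> dotv (pos F i - pos F j) (u i - u j) = 0.

Definition trivial_flex (R : realType) (d : nat) (F : framework R d)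
    (u : nat -> 'cV[R]_d) : Prop :=
  exists (A : 'M[R]_d) (b : 'cV[R]_d),
    A^T = - A /\ forall i, u i = A *m pos F i + b.

Definition stress (R : realType) (d : nat) (F : framework R d)
    (w : nat -> nat -> R) : Prop :=
  (forall i j, w i j = w j i) /\ (forall i j, ~~ edge F i j -> w i j = 0).

Definition equilibrium (R : realType) (d : nat) (F : framework R d)
    (w : nat -> nat -> R) : Prop :=
  forall i, series (fun j => w i j *: (pos F i - pos F j)) @ \oo -->
            (0 : 'cV[R]_d).

Definition lt_pairs : set (nat * nat) := [set ij | (ij.1 < ij.2)%N].

Definition summable_stress (R : realType) (w : nat -> nat -> R) : Prop :=
  summable lt_pairs (fun ij => (w ij.1 ij.2)%:E).

Definition summable_equilibrium_stress (R : realType) (d : nat)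
    (F : framework R d) (w : nat -> nat -> R) : Prop :=
  [/\ stress F w, equilibrium F w & summable_stress w].

(* \esum is meant for nonnegative terms (it is the supremum of the finite
   partial sums), so a signed family is summed through its positive and
   negative parts; both are finite for a summable family. *)
Definition signed_esum (R : realType) (T : choiceType) (D : set T)
    (f : T -> \bar R) : \bar R :=
  (esum D f^\+ - esum D f^\-)%E.

(* sum over i < j of w_ij |u_i - u_j|^2 *)
Definition stress_form (R : realType) (d : nat) (w : nat -> nat -> R)
    (u : nat -> 'cV[R]_d) : \bar R :=
  signed_esum lt_pairs
    (fun ij => (w ij.1 ij.2 * eucl_norm (u ij.1 - u ij.2) ^+ 2)%:E).

Definition IR (R : realType) (d : nat) (F : framework R d) : Prop :=
  forall u, inf_flex F u -> trivial_flex F u.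

Definition BIR (R : realType) (d : nat) (F : framework R d) : Prop :=
  ~ exists u, [/\ inf_flex F u, ~ trivial_flex F u & bounded_field u].

Definition BPS (R : realType) (d : nat) (F : framework R d) : Prop :=
  exists w, summable_equilibrium_stress F w /\
    forall u, inf_flex F u -> bounded_field u -> ~ trivial_flex F u ->
      (0 < stress_form w u)%E.

Definition WBPS (R : realType) (d : nat) (F : framework R d) : Prop :=
  forall u, inf_flex F u -> bounded_field u -> ~ trivial_flex F u ->
    exists w, summable_equilibrium_stress F w /\ (0 < stress_form w u)%E.

(* Only the values q t for t in [0, 1] matter. *)
Definition continuous_motion (R : realType) (d : nat) (F : framework R d)
    (q : R -> nat -> 'cV[R]_d) : Prop :=
  [/\ forall k, {within `[0, 1], continuous (fun t => q t k)},
      q 0 = pos F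
    & forall i j t, edge F i j -> t \in `[0, 1] ->
        eucl_norm (q t i - q t j) = eucl_norm (pos F i - pos F j)].

Definition right_derivative0 (R : realType) (d : nat)
    (q : R -> nat -> 'cV[R]_d) (u : nat -> 'cV[R]_d) : Prop :=
  bounded_field u /\
  linfty_norm (fun k => t^-1 *: (q t k - q 0 k) - u k) @[t --> 0^'+] --> 0%E.

Definition DCR (R : realType) (d : nat) (F : framework R d) : Prop :=
  ~ exists q u, [/\ continuous_motion F q, right_derivative0 q u
                  & ~ trivial_flex F u].

(* Main.v *)
(* Only the last implication needs an argument (for BIR -> BPS the zero stress
   will do).  Let q be a directed bounded motion with velocity u = q'(0) and put
   v = (q(t) - p) / t.  Preservation of the bar ij means
     2 (p_i - p_j).(v_i - v_j) + t |v_i - v_j|^2 = 0;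
   letting t -> 0, u is an infinitesimal flex.  For a summable equilibrium stress
   w and bounded bars, the sum of w_ij (p_i - p_j).(v_i - v_j) over i < j vanishes
   for every bounded field v, so the sum of w_ij |v_i - v_j|^2 vanishes for every
   small t > 0; since v -> u uniformly, w cannot give a positive value on u. *)

Require Import Defs.
From mathcomp Require Import all_boot all_order all_algebra.
From mathcomp Require Import all_classical all_reals all_analysis.
From mathcomp Require Import ring lra.
Set Implicit Arguments.
Unset Strict Implicit.
Unset Printing Implicit Defensive.

Import Order.TTheory GRing.Theory Num.Theory.
Import numFieldNormedType.Exports.

Local Open Scope classical_set_scope.
Local Open Scope ring_scope.

(** * Bilinearity of the Euclidean inner product, and coordinatewise bounds for it *)

Section Dotv.
Variables (R : realType) (d : nat).
Implicit Types x y z : 'cV[R]_d.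

Lemma dotvDl x y z : dotv (x + y) z = dotv x z + dotv y z.
Proof. by rewrite -big_split/=; apply: eq_bigr => k _; rewrite mxE mulrDl. Qed.

Lemma dotvZl a x y : dotv (a *: x) y = a * dotv x y.
Proof. by rewrite mulr_sumr; apply: eq_bigr => k _; rewrite mxE mulrA. Qed.

Lemma dotv0l y : dotv 0 y = 0.
Proof. by rewrite -(scale0r 0) dotvZl mul0r. Qed.

Lemma dotvC x y : dotv x y = dotv y x.
Proof. by apply: eq_bigr => k _; rewrite mulrC. Qed.

Lemma dotvBl x y z : dotv (x - y) z = dotv x z - dotv y z.
Proof. by rewrite dotvDl -scaleN1r dotvZl mulN1r. Qed.

Lemma dotvBr x y z : dotv x (y - z) = dotv x y - dotv x z.
Proof. by rewrite dotvC dotvBl !(dotvC x). Qed.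

Lemma dotv_suml (I : Type) (r : seq I) (f : I -> 'cV[R]_d) y :
  dotv (\sum_(i <- r) f i) y = \sum_(i <- r) dotv (f i) y.
Proof.
elim: r => [|i r IH]; first by rewrite !big_nil dotv0l.
by rewrite !big_cons dotvDl IH.
Qed.

Lemma dotv_ge0 x : 0 <= dotv x x.
Proof. by apply: sumr_ge0 => k _; exact: sqr_ge0. Qed.

Lemma eucl_norm_sqr x : eucl_norm x ^+ 2 = dotv x x.
Proof. by rewrite sqr_sqrtr ?dotv_ge0. Qed.

Lemma ler_coord_eucl_norm x k : `|x k 0| <= eucl_norm x.
Proof.
rewrite -sqrtr_sqr ler_wsqrtr// /dotv (bigD1 k)//= expr2 lerDl.
by apply: sumr_ge0 => l _; exact: sqr_ge0.
Qed.

Lemma ler_norm_dotv x y a b :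
    (forall k, `|x k 0| <= a) -> (forall k, `|y k 0| <= b) ->
  `|dotv x y| <= d%:R * (a * b).
Proof.
move=> xa yb; apply: (le_trans (ler_norm_sum _ _ _)).
apply: (@le_trans _ _ (\sum_(k < d) a * b)).
  by apply: ler_sum => k _; rewrite normrM ler_pM.
by rewrite sumr_const card_ord mulr_natl.
Qed.

(** The difference of squared lengths factors as (x - y).(x + y): it is small when [x - y] is small
    and [x + y] stays bounded. *)
Lemma ler_norm_dotvB x y a b :
    (forall k, `|(x - y) k 0| <= a) -> (forall k, `|(x + y) k 0| <= b) ->
  `|dotv x x - dotv y y| <= d%:R * (a * b).
Proof.
move=> xa yb; rewrite (_ : _ - _ = dotv (x - y) (x + y)); first exact: ler_norm_dotv.
by rewrite dotvBl !(dotvC _ (x + y)) !dotvDl (dotvC y x); ring.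
Qed.

Lemma cvg_dotv_l (u : nat -> 'cV[R]_d) y :
  u @ \oo --> (0 : 'cV[R]_d) -> dotv (u n) y @[n --> \oo] --> 0.
Proof.
move=> u0.
suff : dotv (u n) y @[n --> \oo] --> \sum_(k < d) 0 * y k 0.
  by rewrite big1// => k _; rewrite mul0r.
apply: cvg_big; first exact: add_continuous.
move=> k _; apply: cvgMl.
have := @coord_continuous R d 1 k 0 (0 : 'cV[R]_d).
by move=> /(cvg_comp _ _ u0); rewrite mxE.
Qed.

End Dotv.

(** * Sums over pairs i < j, exhausted by finite triangles *)

Section TriangularSums.
Variable R : realType.
Implicit Types f g : nat -> nat -> R.

(** The larger index is outermost, so that raising [N] appends columns and a tail is a sum over N <=
    j < m. *)
Definition tri_sum f (N : nat) : R := \sum_(0 <= j < N) \sum_(0 <= i < j) f i j.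

Lemma eq_tri_sum f g N : (forall i j, f i j = g i j) ->
  tri_sum f N = tri_sum g N.
Proof. by move=> fg; apply: eq_bigr => j _; apply: eq_bigr => i _. Qed.

Lemma tri_sumD f g N :
  tri_sum (fun i j => f i j + g i j) N = tri_sum f N + tri_sum g N.
Proof. by rewrite -big_split; apply: eq_bigr => j _; rewrite big_split. Qed.

Lemma tri_sumZ a f N : tri_sum (fun i j => a * f i j) N = a * tri_sum f N.
Proof. by rewrite mulr_sumr; apply: eq_bigr => j _; rewrite mulr_sumr. Qed.

Lemma ler_norm_tri_sum f g N : (forall i j, `|f i j| <= g i j) ->
  `|tri_sum f N| <= tri_sum g N.
Proof.
move=> fg; apply: (le_trans (ler_norm_sum _ _ _)); apply: ler_sum => j _.
by apply: (le_trans (ler_norm_sum _ _ _)); apply: ler_sum.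
Qed.

(** The square is the triangle, its reflection and a diagonal that contributes nothing. *)
Lemma tri_sum_square f N : (forall i, f i i = 0) ->
  tri_sum (fun i j => f i j + f j i) N =
  \sum_(0 <= i < N) \sum_(0 <= j < N) f i j.
Proof.
move=> f0; elim: N => [|N IH]; first by rewrite /tri_sum !big_geq.
rewrite /tri_sum !big_nat_recr//= [X in X + _]IH f0 addr0.
under [in RHS]eq_bigr do rewrite big_nat_recr//=.
by rewrite !big_split/= addrA.
Qed.

Definition triangle N := [seq (i, j) | j <- iota 0 N, i <- iota 0 j].

Lemma mem_triangle N i j : ((i, j) \in triangle N) = (i < j < N)%N.
Proof.
apply/allpairsPdep/idP => [[j' [i' []]]|/andP[ij jN]].
  by rewrite !mem_iota/= !add0n => jN ij [-> ->]; rewrite ij.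
by exists j, i; rewrite !mem_iota.
Qed.

Lemma triangle_uniq N : uniq (triangle N).
Proof.
apply: allpairs_uniq_dep => [|j _|]; rewrite ?iota_uniq//.
by move=> [j i] [j' i'] _ _ /= [-> ->].
Qed.

Lemma fsum_triangle (f : nat * nat -> R) N :
  (\sum_(x \in [set` triangle N]) (f x)%:E)%E =
  (tri_sum (fun i j => f (i, j)) N)%:E.
Proof.
rewrite -fsbig_seq ?triangle_uniq// sumEFin big_allpairs_dep_idem/=.
- by rewrite /tri_sum /index_iota subn0; congr EFin; apply: eq_bigr => j _; rewrite subn0.
- exact: addr0.
Qed.

Lemma triangle_fsets N : fsets lt_pairs [set` triangle N].
Proof.
split; first exact: finite_seq.
by move=> [i j] /=; rewrite mem_triangle => /andP[].
Qed.

Lemma finite_sub_triangle (X : set (nat * nat)) : fsets lt_pairs X ->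
  exists N0, forall N, (N0 <= N)%N -> X `<=` [set` triangle N].
Proof.
move=> [/finite_seqP[s ->] slt].
exists (\max_(x <- s) x.2.+1)%N => N N0N [i j] /= sij.
rewrite mem_triangle (slt _ sij)/=; apply: leq_trans N0N.
by rewrite (big_rem _ sij)/= leq_maxl.
Qed.

Lemma tri_sum_le_esum (f : nat * nat -> R) N :
  ((tri_sum (fun i j => f (i, j)) N)%:E <= \esum_(x in lt_pairs) (f x)%:E)%E.
Proof.
apply: ereal_sup_ubound; exists [set` triangle N]; first exact: triangle_fsets.
by rewrite fsum_triangle.
Qed.

(** The negative parts have a finite sum [b], and some finite set [X] of pairs carries positive
    parts exceeding [b]. Every triangle containing [X] keeps this surplus, since its negative parts
    never exceed [b]. *)
Lemma signed_esum_gt0 f :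
  (0 < signed_esum lt_pairs (fun ij => (f ij.1 ij.2)%:E))%E ->
  exists2 e, 0 < e & exists N0, forall N, (N0 <= N)%N -> e <= tri_sum f N.
Proof.
pose fp (x : nat * nat) := Num.max (f x.1 x.2) 0.
pose fn (x : nat * nat) := Num.max (- f x.1 x.2) 0.
rewrite /signed_esum.
have -> : ((fun ij : nat * nat => (f ij.1 ij.2)%:E)^\+ = fun x => (fp x)%:E)%E.
  by apply/funext => x; rewrite funeposE /fp EFin_max.
have -> : ((fun ij : nat * nat => (f ij.1 ij.2)%:E)^\- = fun x => (fn x)%:E)%E.
  by apply/funext => x; rewrite funenegE /fn EFin_max.
rewrite sube_gt0 => lt_np.
have n_ge0 : (0 <= \esum_(x in lt_pairs) (fn x)%:E)%E.
  by apply: esum_ge0 => x _; rewrite lee_fin le_max lexx orbT.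
move: lt_np n_ge0 (tri_sum_le_esum fn).
case: (\esum_(x in lt_pairs) (fn x)%:E)%E => [b| |]// + _ le_b.
  move=> /ereal_sup_gt[_ [X fX <-]].
  rewrite fsumEFin; last by case: fX.
  rewrite lte_fin => bX; exists (\sum_(x \in X) fp x - b); first by rewrite subr_gt0.
  have [N0 XN0] := finite_sub_triangle fX; exists N0 => N /XN0 XN.
  have : ((\sum_(x \in X) (fp x)%:E)%R <= (\sum_(x \in [set` triangle N]) (fp x)%:E)%R)%E.
    apply: lee_fsum_nneg_subset; [by case: fX|exact: finite_seq| |].
      by move=> x; rewrite !inE => /XN.
    by move=> x _; rewrite lee_fin le_max lexx orbT.
  rewrite fsumEFin; last by case: fX.
  rewrite fsum_triangle lee_fin => leX.
  have := le_b N; rewrite lee_fin => le_bN.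
  rewrite (@eq_tri_sum f (fun i j => fp (i, j) + -1 * fn (i, j))).
    by rewrite tri_sumD tri_sumZ mulN1r lerB.
  move=> i j; rewrite /fp /fn/=; case: (leP (f i j) 0) => ?.
    by rewrite max_l ?oppr_ge0//; ring.
  by rewrite max_r ?oppr_le0 ?ltW//; ring.
by rewrite ltNge leey.
Qed.

Lemma tri_sum_norm_homo f :
  {homo tri_sum (fun i j => `|f i j|) : m n / (m <= n)%N >-> m <= n}.
Proof.
move=> m n mn; rewrite /tri_sum (big_cat_nat _ mn)//= lerDl.
by apply: sumr_ge0 => j _; apply: sumr_ge0.
Qed.

Lemma summable_tri_sum f : summable_stress f ->
  cvgn (tri_sum (fun i j => `|f i j|)).
Proof.
rewrite /summable_stress /summable => fs.
apply: nondecreasing_is_cvgn; first exact: tri_sum_norm_homo.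
have := tri_sum_le_esum (fun x => `|f x.1 x.2|).
have : (\esum_(x in lt_pairs) (`|f x.1 x.2|)%:E < +oo)%E by [].
case: (\esum_(x in _) _)%E => [b| |]// _ le_b.
  by exists b => _ [N _ <-]; rewrite -lee_fin.
(* Only the value [-oo] is left; it would lie above a real partial sum, so the bound 0 is a
   dummy. *)
by exists 0 => _ [N _ <-]; have := le_b N.
Qed.

End TriangularSums.

(** * Equilibrium stresses tested against directed bounded motions *)

Section Frameworks.
Variables (R : realType) (d : nat) (F : framework R d).
Implicit Types (w : nat -> nat -> R) (u v : nat -> 'cV[R]_d).

Lemma bounded_field_coord v : bounded_field v ->
  exists2 C, 0 <= C & forall i k, `|v i k 0| <= C.
Proof.
rewrite /bounded_field /linfty_norm => vfin.
have := @ereal_sup_ubound _ (range (fun k => (eucl_norm (v k))%:E)).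
move: vfin; case: (ereal_sup _) => [C| |]// _ ub.
  have ubC i : eucl_norm (v i) <= C by rewrite -lee_fin; apply: ub; exists i.
  exists C => [|i k]; first by apply: le_trans (ubC 0%N); exact: sqrtr_ge0.
  by apply: le_trans (ubC i); exact: ler_coord_eucl_norm.
by have := ub _ (ex_intro2 _ _ 0%N I erefl).
Qed.

Lemma bounded_bar_coord : bounded_bar_lengths F ->
  exists2 M, 0 <= M & forall i j, edge F i j ->
    forall k, `|(pos F i - pos F j) k 0| <= M.
Proof.
rewrite /bounded_bar_lengths; set S := [set x | _] => Sfin.
have := @ereal_sup_ubound _ S.
move: Sfin; case: (ereal_sup S) => [C| |]// _ ub.
  exists (Num.max C 0) => [|i j ij k]; first by rewrite le_max lexx orbT.
  rewrite le_max (le_trans (ler_coord_eucl_norm _ _))// -lee_fin.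
  by apply: ub; exists i, j.
(* The supremum is [-oo] here, so there are no bars and any bound will do. *)
exists 0 => // i j ij.
have /ub : S (eucl_norm (pos F i - pos F j))%:E by exists i, j.
by [].
Qed.

(* By symmetry the N-th triangular sum is sum_{i<N} v_i . sum_{j<N} w_ij (p_i - p_j),
   and each inner sum is, by equilibrium, minus its own tail. *)
Lemma equilibrium_work_cvg0 w v M C :
    stress F w -> equilibrium F w -> cvgn (tri_sum (fun i j => `|w i j|)) ->
    0 <= M -> (forall i j, edge F i j -> forall k, `|(pos F i - pos F j) k 0| <= M) ->
    0 <= C -> (forall i k, `|v i k 0| <= C) ->
  tri_sum (fun i j => w i j * dotv (pos F i - pos F j) (v i - v j)) N @[N --> \oo]
    --> 0.
Proof.
move=> [wC w0] weq wcvg M0 barM C0 vC.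
(* [h i j] is the work of the bar force at the end [i]; by symmetry of [w], [h i j + h j i] is the
   work of the whole bar. *)
pose h i j := dotv (w i j *: (pos F i - pos F j)) (v i).
pose K := d%:R * (M * C); have K0 : 0 <= K by rewrite !mulr_ge0.
set a := tri_sum (fun i j => `|w i j|) in wcvg *.
have hK i j : `|h i j| <= K * `|w i j|.
  rewrite /h dotvZl normrM mulrC; case: (boolP (edge F i j)) => [ij|/w0 ->].
    by rewrite ler_wpM2r// ler_norm_dotv//; exact: barM.
  by rewrite normr0 !mulr0.
have PE N : tri_sum (fun i j => w i j * dotv (pos F i - pos F j) (v i - v j)) N =
    \sum_(0 <= i < N) \sum_(0 <= j < N) h i j.
  rewrite -tri_sum_square => [|i]; last by rewrite /h subrr scaler0 dotv0l.
  by apply: eq_tri_sum => i j; rewrite /h !dotvZl -(wC i j) dotvBr !dotvBl; ring.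
(* Full row sums vanish by equilibrium, so the square is minus the rectangle i < N <= j, which lies
   in the tail of the triangular sums. The slack [e] pays for cutting the rows at a finite [m]. *)
have PK N : `|\sum_(0 <= i < N) \sum_(0 <= j < N) h i j| <= K * (limn a - a N).
  apply/ler_addgt0Pr => e e0.
  have : \sum_(0 <= i < N) \sum_(0 <= j < m) h i j @[m --> \oo] -->
         \sum_(0 <= i < N) (0 : R).
    apply: cvg_big; first exact: add_continuous.
    move=> i _; have := cvg_dotv_l (v i) (weq i).
    by under eq_fun do rewrite dotv_suml.
  rewrite big1// => /cvgr0Pnorm_le/(_ e e0) [m0 _ m0P].
  have := m0P (maxn m0 N) (leq_maxl _ _) => /=.
  have Nm := leq_maxr m0 N; move: (maxn m0 N) Nm => m Nm rm.
  have am : a m <= limn a by apply: nondecreasing_cvgn_le => //; exact: tri_sum_norm_homo.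
  have tail : `|\sum_(0 <= i < N) \sum_(N <= j < m) h i j| <= K * (a m - a N).
    have -> : a m - a N = \sum_(N <= j < m) \sum_(0 <= i < j) `|w i j|.
      by rewrite /a /tri_sum (big_cat_nat _ Nm)//=; ring.
    rewrite exchange_big/= mulr_sumr.
    apply: (le_trans (ler_norm_sum _ _ _)); rewrite big_nat [leRHS]big_nat.
    apply: ler_sum => j /andP[Nj _]; apply: (le_trans (ler_norm_sum _ _ _)).
    (* As N <= j, column [j] of the triangle contains the rows i < N; its other terms are
       nonnegative and are dropped. *)
    rewrite (big_cat_nat _ Nj)//= mulrDr mulr_sumr -[leLHS]addr0.
    apply: lerD; first exact: ler_sum.
    by rewrite mulr_ge0// sumr_ge0.
  have split_m : \sum_(0 <= i < N) \sum_(0 <= j < m) h i j =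
     \sum_(0 <= i < N) \sum_(0 <= j < N) h i j +
     \sum_(0 <= i < N) \sum_(N <= j < m) h i j.
    by rewrite -big_split; apply: eq_bigr => i _; rewrite (big_cat_nat _ Nm).
  rewrite (_ : \sum_(0 <= i < N) \sum_(0 <= j < N) h i j =
     \sum_(0 <= i < N) \sum_(0 <= j < m) h i j -
     \sum_(0 <= i < N) \sum_(N <= j < m) h i j); last by rewrite split_m addrK.
  rewrite [leRHS]addrC; apply: (le_trans (ler_normB _ _)); apply: lerD => //.
  by apply: (le_trans tail); rewrite ler_wpM2l// lerB.
under eq_fun do rewrite PE.
have K0lim : K * (limn a - a N) @[N --> \oo] --> 0.
  rewrite -(mulr0 K) -(subrr (limn a)).
  by apply: cvgMr; apply: cvgB => //; exact: cvg_cst.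
apply/cvgr0Pnorm_le => e e0.
move/cvgr0Pnorm_le: K0lim => /(_ e e0) [N0 _ N0P]; exists N0 => // N /N0P/= le_e.
by apply: le_trans (PK N) _; apply: le_trans le_e; exact: ler_norm.
Qed.

(** Squaring the equal lengths leaves [t] times the stated expression, and [t] cancels. *)
Lemma edge_expansion (x y : 'cV[R]_d) t :
  t != 0 -> eucl_norm (x + t *: y) = eucl_norm x ->
  2 * dotv x y + t * dotv y y = 0.
Proof.
move=> t0 /(congr1 (fun z => z ^+ 2)); rewrite !eucl_norm_sqr.
rewrite dotvDl !(dotvC _ (x + _)) !dotvDl !dotvZl.
rewrite (dotvC x (t *: y)) (dotvC y (t *: y)) !dotvZl (dotvC y x) => e.
apply: (mulfI t0); rewrite mulr0; lra.
Qed.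

(** Extracts from the motion a single difference quotient [v] close to [u] at all vertices at once;
    the limit t -> 0 is replaced by an arbitrary [delta]. The condition delta <= 1 keeps [t] in the
    time interval. *)
Lemma difference_quotient_near q u delta : 0 < delta -> delta <= 1 ->
    continuous_motion F q -> right_derivative0 q u ->
  exists t v, [/\ 0 < t <= delta,
    forall i j, edge F i j -> 2 * dotv (pos F i - pos F j) (v i - v j) +
                              t * dotv (v i - v j) (v i - v j) = 0
    & forall i k, `|(v i - u i) k 0| <= delta].
Proof.
move=> delta0 delta1 [_ q0 qlen] [_ qu].
pose L t := linfty_norm (fun k => t^-1 *: (q t k - q 0 k) - u k).
have near_qu : \forall t \near 0^'+, (L t < delta%:E)%E.
  have : nbhs (0 : \bar R)%E [set y | (y < delta%:E)%E].
    by apply: open_nbhs_nbhs; split; [exact: open_ereal_lt_ereal|rewrite /= lte_fin].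
  exact: qu.
near (0:R)^'+ => t.
have t0 : 0 < t by near: t; exact: nbhs_right_gt.
have td : t <= delta by near: t; exact: nbhs_right_le.
have lt_qu : (L t < delta%:E)%E by near: t.
exists t, (fun i => t^-1 *: (q t i - q 0 i)); split.
- by rewrite t0.
- move=> i j ij; apply: edge_expansion; first by rewrite gt_eqF.
  rewrite -scalerBr scalerA divff ?gt_eqF// scale1r -(qlen i j t ij).
    by congr eucl_norm; apply/matrixP => a b; rewrite q0 !mxE; ring.
  by rewrite in_itv/= (ltW t0) (le_trans td).
- move=> i k; apply: (le_trans (ler_coord_eucl_norm _ _)).
  rewrite -lee_fin; apply: le_trans (ltW lt_qu).
  by apply: ereal_sup_ubound; exists i.
Unshelve. all: by end_near. Qed.

Lemma le0_of_le_small (x B : R) :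
  (forall delta, 0 < delta -> delta <= 1 -> x <= delta * B) -> x <= 0.
Proof.
move=> xB; apply/ler_addgt0Pr => e e0; rewrite add0r.
(* The added 1 keeps the denominator positive, whatever the sign of [B]. *)
pose delta := Num.min 1 (e / (`|B| + 1)).
have B1 : 0 < `|B| + 1 by rewrite ltr_wpDl.
have delta0 : 0 < delta by rewrite lt_min ltr01 divr_gt0.
apply: (le_trans (xB _ delta0 _)); first by rewrite ge_min lexx.
apply: (@le_trans _ _ (delta * (`|B| + 1))).
  by rewrite ler_pM2l// (le_trans (ler_norm B))// lerDl.
by rewrite -ler_pdivlMr// ge_min lexx orbT.
Qed.

Lemma ler_norm_coordB v c i j k : (forall i k, `|v i k 0| <= c) ->
  `|(v i - v j) k 0| <= c + c.
Proof. by move=> vc; rewrite !mxE (le_trans (ler_normB _ _))// lerD. Qed.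

Lemma right_derivative0_inf_flex q u :
  continuous_motion F q -> right_derivative0 q u -> inf_flex F u.
Proof.
move=> Fq qu i j ij; have [ubd _] := qu.
have [C C0 uC] := bounded_field_coord ubd.
set p := pos F i - pos F j; pose D := C + 1 + (C + 1).
apply/eqP; rewrite -normr_le0.
(* The first summand bounds the error of replacing [u] by [v]; the second bounds the quadratic term,
   [D] being a bound on the coordinates of [v i - v j]. *)
apply: (@le0_of_le_small _
  (d%:R * (eucl_norm p * 2) + d%:R * (D * D))) => delta delta0 delta1.
have [t [v [/andP[t0 tdelta] vflex vu]]] := difference_quotient_near delta0 delta1 Fq qu.
have vC l k : `|v l k 0| <= C + 1.
  rewrite -[v l](subrK (u l)) mxE addrC (le_trans (ler_normD _ _))// lerD//.
  exact: le_trans (vu l k) delta1.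
have pvu : `|dotv p ((v i - v j) - (u i - u j))| <= d%:R * (eucl_norm p * (delta + delta)).
  apply: ler_norm_dotv => k; first exact: ler_coord_eucl_norm.
  rewrite (_ : _ - _ = (v i - u i) - (v j - u j)); last first.
    by apply/matrixP => a b; rewrite !mxE; ring.
  by apply: (@ler_norm_coordB (fun l => v l - u l)).
have vv : `|dotv (v i - v j) (v i - v j)| <= d%:R * (D * D).
  by apply: ler_norm_dotv => k; exact: ler_norm_coordB.
have tvv : t * `|dotv (v i - v j) (v i - v j)| <= delta * (d%:R * (D * D)).
  by rewrite ler_pM// ltW.
have := vflex i j ij; rewrite -/p; move: pvu; rewrite dotvBr.
move: tvv; rewrite -(ger0_norm (ltW t0)) -normrM (ger0_norm (ltW t0)).
set a := dotv p _; set b := dotv p _; set c := t * _; set m := d%:R * (D * D).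
rewrite !ler_norml => /andP[cl cr] /andP[abl abr] ac.
by apply/andP; split; lra.
Qed.

(** For fixed [v] the triangular sums of w_ij |v_i - v_j|^2 tend to 0. Those for [u] differ from
    them by O(delta) uniformly in [N], because [w] is summable, so they cannot stay above a fixed
    [e] > 0. *)
Lemma stress_form_Ngt0 w q u :
    bounded_bar_lengths F -> summable_equilibrium_stress F w ->
    continuous_motion F q -> right_derivative0 q u ->
  ~ (0 < stress_form w u)%E.
Proof.
move=> hF [ws weq wsum] Fq qu.
move=> /(@signed_esum_gt0 _ (fun i j => w i j * eucl_norm (u i - u j) ^+ 2)).
move=> [e e0 [N0 eN0]]; have [ubd _] := qu.
have [C C0 uC] := bounded_field_coord ubd.
have [M M0 barM] := bounded_bar_coord hF.
have wcvg := summable_tri_sum wsum.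
set a := tri_sum (fun i j => `|w i j|) in wcvg.
(* [E] bounds the coordinates of [v l] plus those of [u l]; [delta * D] then bounds the change in
   squared length from [v] to [u] on any pair. *)
pose E := C + 1 + C; pose D := d%:R * (2 * (E + E)).
move: e0; apply/negP; rewrite -leNgt.
(* The 1 covers the sum for [v], at most [delta] for large [N]; [limn a * D] covers the passage from
   [v] to [u]. *)
apply: (@le0_of_le_small _ (1 + limn a * D)) => delta delta0 delta1.
have [t [v [/andP[t0 tdelta] vflex vu]]] := difference_quotient_near delta0 delta1 Fq qu.
have vC l k : `|v l k 0| <= C + 1.
  rewrite -[v l](subrK (u l)) mxE addrC (le_trans (ler_normD _ _))// lerD//.
  exact: le_trans (vu l k) delta1.
have Tv0 : tri_sum (fun i j => w i j * eucl_norm (v i - v j) ^+ 2) N @[N --> \oo] --> 0.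
  have C1 : 0 <= C + 1 by rewrite addr_ge0.
  have := equilibrium_work_cvg0 ws weq wcvg M0 barM C1 vC.
  move=> workcvg.
  (* On a bar, length preservation turns the quadratic term into -2/t times the work term; elsewhere
     [w] vanishes. *)
  have -> : tri_sum (fun i j => w i j * eucl_norm (v i - v j) ^+ 2) = (fun N => - 2 / t *
      tri_sum (fun i j => w i j * dotv (pos F i - pos F j) (v i - v j)) N).
    apply/funext => N; rewrite -tri_sumZ; apply: eq_tri_sum => i j.
    case: (boolP (edge F i j)) => [ij|/(proj2 ws) ->]; last by rewrite !mul0r mulr0.
    rewrite eucl_norm_sqr mulrCA; congr (_ * _); apply: (mulfI (lt0r_neq0 t0)).
    by rewrite mulrA mulrCA divff ?gt_eqF// mulr1 mulNr -[RHS]add0r -(vflex i j ij); ring.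
  by rewrite -(mulr0 (- 2 / t)); apply: cvgMr.
move/cvgr0Pnorm_le: Tv0 => /(_ _ delta0) [N1 _ N1P].
have := N1P (maxn N0 N1) (leq_maxr _ _) => /= Tv.
have := eN0 (maxn N0 N1) (leq_maxl _ _); move: (maxn N0 N1) Tv => N Tv Tu.
have aD : a N <= limn a by apply: nondecreasing_cvgn_le => //; exact: tri_sum_norm_homo.
have Tuv : `|tri_sum (fun i j => w i j * eucl_norm (u i - u j) ^+ 2 +
    - 1 * (w i j * eucl_norm (v i - v j) ^+ 2)) N| <= delta * D * a N.
  rewrite -tri_sumZ; apply: ler_norm_tri_sum => i j.
  rewrite mulN1r -mulrBr normrM mulrC ler_wpM2r// !eucl_norm_sqr distrC.
  rewrite (_ : delta * D = d%:R * ((delta + delta) * (E + E))); last by rewrite /D; ring.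
  apply: ler_norm_dotvB => k.
    rewrite (_ : _ - _ = (v i - u i) - (v j - u j)); last first.
      by apply/matrixP => l m; rewrite !mxE; ring.
    by apply: (@ler_norm_coordB (fun l => v l - u l)).
  rewrite mxE (le_trans (ler_normD _ _))//.
  rewrite (_ : E + E = (C + 1 + (C + 1)) + (C + C)); last by rewrite /E; ring.
  by rewrite lerD// ler_norm_coordB.
have E0 : 0 <= E by rewrite !addr_ge0.
have D0 : 0 <= D by rewrite !mulr_ge0// addr_ge0.
have := ler_wpM2l (mulr_ge0 (ltW delta0) D0) aD.
move: Tuv; rewrite tri_sumD tri_sumZ => Tuv.
move: Tv Tuv; rewrite !ler_norml => /andP[_ Tv] /andP[_ Tuv] aL.
lra.
Qed.

End Frameworks.

Theorem theorem3p19 (R : realType) (d : nat) (F : framework R d)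
    (hF : bounded_bar_lengths F) :
  [/\ IR F -> BIR F,
      BIR F -> BPS F,
      BPS F -> WBPS F
    & WBPS F -> DCR F].
Proof.
split.
- by move=> ir [u [uflex unt _]]; exact: unt (ir u uflex).
- move=> bir; exists (fun _ _ => 0); split; last first.
    (* Positivity is demanded only on fields that [BIR] excludes. *)
    by move=> u uflex ubd unt; case: bir; exists u.
  split=> //.
  + move=> i; rewrite (_ : series _ = fun=> 0); first exact: cvg_cst.
    by apply/funext => n; rewrite /series/= big1// => j _; rewrite scale0r.
  + by rewrite /summable_stress /summable esum1// => x _; rewrite abse0.
- by move=> [w [wF wpos]] u uflex ubd unt; exists w; split=> //; exact: wpos.
- move=> wbps [q [u [Fq qu unt]]].
  have [w [wF]] := wbps u (right_derivative0_inf_flex Fq qu) (proj1 qu) unt.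
  exact: stress_form_Ngt0 hF wF Fq qu.
Qed.
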